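(* Let $\mathcal{C}=(p_1,\ldots,p_M\,;q)$ be a cookie environment such that $p_i=0$ for all $i\le\lfloor M/2\rfloor$, where $\lfloor x\rfloor$ denotes the integer part of $x$. Define $$\lambda_{\mathrm{sym}}(\mathcal{C})=\frac{q}{b(1-q)}\prod_{i=1}^M\left((1-p_i)\left(\frac{q}{b(1-q)}\right)+\frac{(b-1)p_i}{b}+\frac{p_i}{b}\left(\frac{q}{b(1-q)}\right)^{-1}\right).$$ If $q<\frac{b}{b+1}$, then $\lambda(\mathcal{C})=\lambda_{\mathrm{sym}}(\mathcal{C})$, where $\lambda(\mathcal{C})$ is the largest spectral radius of the irreducible sub-matrices, attached to the irreducible classes other than $\{0\}$, of the cookie environment matrix $P(\mathcal{C})$.
   Context: Fix an integer $b\ge2$. A cookie environment is a vector $\mathcal{C}=(p_1,\ldots,p_M\,;q)\in[0,1)^M\times(0,1)$ with $M\ge1$. Cookie environment matrix. Let $(\xi_i)_{i\ge1}$ be independent random variables with values in $\{0,1,\ldots,b\}$ such that $\mathbf{P}\{\xi_i=0\}=1-p_i$ and $\mathbf{P}\{\xi_i=k\}=p_i/b$ ($1\le k\le b$) if $i\le M$, and $\mathbf{P}\{\xi_i=0\}=1-q$, $\mathbf{P}\{\xi_i=k\}=q/b$ if $i>M$. A ''failure'' is an index $i$ with $\xi_i=0$. The matrix $P=P(\mathcal{C})=(p(i,j))_{i,j\ge0}$ is defined by $p(0,j)=\mathbf{1}_{\{j=0\}}$ and, for $i\ge1$, $p(i,j)$ is the probability that exactly $j$ of the $\xi_n$'s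 take the value $1$ before the $i$-th failure in $(\xi_1,\xi_2,\ldots)$. Irreducible classes. Write $i\to j$ if $(P^n)(i,j)>0$ for some $n\ge1$, and $i\leftrightarrow j$ if $i\to j$ and $j\to i$. On $\{i\ge0: i\leftrightarrow i\}$ the relation $\leftrightarrow$ is an equivalence relation with finitely many classes, called the irreducible classes of $P$; $\{0\}$ is one of them. The sub-matrix attached to a class $S$ is $(p(i,j))_{i,j\in S}$. Spectral radius. The spectral radius of an irreducible non-negative (possibly infinite) matrix $Q$ is $\lim_{n\to\infty}\big(q^{(n)}(i,j)\big)^{1/n}$, where $q^{(n)}(i,j)$ is the $(i,j)$ coefficient of $Q^n$; it does not depend on $i,j$. *)

(* Defs.v *)
From mathcomp Require Export all_boot all_order all_algebra.
From mathcomp Require Export all_classical all_reals all_analysis.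

Set Implicit Arguments.
Unset Strict Implicit.
Unset Printing Implicit Defensive.

Import Order.TTheory GRing.Theory Num.Theory.
Import numFieldNormedType.Exports.

Local Open Scope classical_set_scope.
Local Open Scope ring_scope.

(* Sequences are indexed from 0 and cookies by 'I_M: index n here is index
   n + 1 in the usual 1-based numbering. *)

Definition is_cookie_env (R : realType) (M : nat) (p : 'I_M -> R) (q : R) :=
  [/\ (0 < M)%N, forall i, 0 <= p i < 1 & 0 < q < 1].

Definition cookie_strength (R : realType) (M : nat) (p : 'I_M -> R) (q : R)
    (n : nat) : R :=
  if insub n is Some i then p i else q.

Definition mutually_independent d (T : measurableType d) (R : realType)
    (Pr : probability T R) d' (T' : measurableType d')
    (X : nat -> {RV Pr >-> T'}) :=
  forall (J : seq nat) (B : nat -> set T'),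
    uniq J -> (forall n, measurable (B n)) ->
    Pr [set w | forall n, n \in J -> B n (X n w)] =
    (\prod_(n <- J) Pr (X n @^-1` B n))%E.

Definition is_cookie_sequence d (T : measurableType d) (R : realType)
    (Pr : probability T R) (b M : nat) (p : 'I_M -> R) (q : R)
    (xi : nat -> {RV Pr >-> nat}) :=
  [/\ mutually_independent xi,
      forall n w, (xi n w <= b)%N,
      forall n, Pr (xi n @^-1` [set 0%N]) = (1 - cookie_strength p q n)%:E
    & forall n k, (1 <= k <= b)%N ->
        Pr (xi n @^-1` [set k]) = (cookie_strength p q n / b%:R)%:E].

(* Number of indices m < n with x m = v. *)
Definition occurrences (x : nat -> nat) (v n : nat) : nat :=
  (\sum_(m < n) (x m == v))%N.

(* The i-th failure (i >= 1) takes place, at some index n, and exactly j of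
   the x m with m < n are equal to 1. *)
Definition ones_before_failure (i j : nat) (x : nat -> nat) : Prop :=
  exists n, [/\ x n = 0%N, (occurrences x 0 n).+1 = i & occurrences x 1 n = j].

Definition cookie_matrix d (T : measurableType d) (R : realType)
    (Pr : probability T R) (xi : nat -> {RV Pr >-> nat}) (i j : nat) : \bar R :=
  if i is 0%N then ((j == 0%N)%:R)%:E
  else Pr [set w | ones_before_failure i j (fun n => xi n w)].

(* (i, j) coefficient of the n-th power of the sub-matrix (Q i j)_{i, j in S};
   the entries of Q are non-negative, so the sums exist in \bar R. *)
Fixpoint submx_pow (R : realType) (Q : nat -> nat -> \bar R) (S : set nat)
    (n : nat) (i j : nat) : \bar R :=
  if n is m.+1 then \esum_(k in S) (Q i k * submx_pow Q S m k j)%E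
  else ((i == j)%:R)%:E.

Definition leads_to (R : realType) (Q : nat -> nat -> \bar R) (i j : nat) :=
  exists2 n, (0 < n)%N & (0 < submx_pow Q setT n i j)%E.

Definition communicates (R : realType) (Q : nat -> nat -> \bar R)
    (i j : nat) :=
  leads_to Q i j /\ leads_to Q j i.

Definition irreducible_class (R : realType) (Q : nat -> nat -> \bar R)
    (S : set nat) :=
  exists2 i, communicates Q i i & S = [set j | communicates Q i j].

(* Existence of the limit and its independence of i, j are part of the
   predicate. *)
Definition is_spectral_radius (R : realType) (Q : nat -> nat -> \bar R)
    (S : set nat) (r : \bar R) :=
  forall i j, S i -> S j ->
    (fun n : nat => poweR (submx_pow Q S n i j) (n%:R^-1)) @ \oo --> r.

Definition is_largest_spectral_radius (R : realType)
    (Q : nat -> nat -> \bar R) (r : \bar R) :=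
  (exists S, [/\ irreducible_class Q S, S <> [set 0%N]
               & is_spectral_radius Q S r]) /\
  (forall S, irreducible_class Q S -> S <> [set 0%N] ->
     exists2 s, is_spectral_radius Q S s & (s <= r)%E).

Definition lambda_sym (R : realType) (b M : nat) (p : 'I_M -> R) (q : R) : R :=
  let r := q / (b%:R * (1 - q)) in
  r * \prod_(i < M)
        ((1 - p i) * r + (b%:R - 1) * p i / b%:R + p i / b%:R * r^-1).

(* Main.v *)
Require Import Defs.
From mathcomp Require Import all_boot all_order all_algebra.
From mathcomp Require Import all_classical all_reals all_analysis.
From mathcomp Require Import ring lra zify.

Import Order.TTheory GRing.Theory Num.Theory.
Import numFieldNormedType.Exports.
Local Open Scope classical_set_scope.
Local Open Scope ring_scope.

(** Write c_n for the strength of the cookie of index n, r = q / (b (1 - q)) and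
    m for the integer part of M / 2. The hypothesis on q says that r < 1.

    The pair (failures, ones) counted over the first n trials has generating
    function prod_(l < n) ((1 - c_l) X + (b - 1) c_l / b + (c_l / b) Y), and
    p(i + 1, j) is the sum over n of the probability that this pair is (i, j)
    and that the trial n fails. Weighting the row i by s ^ i amounts to setting
    X = s. Call A_n(Y) the resulting polynomial. Since the first m cookies are
    null, A_n has degree at most n - m; so for j > m the trials n < M contribute
    nothing to the column j, and the geometric series over n >= M gives
      sum_i s^i p(i, j) = s (1 - q) [Y^j] A_M(Y) / (1 - al - be Y),
    where al = (1 - q) s + (b - 1) q / b and be = q / b.

    - For s = r the pole of the right-hand side is Y = 1 / r. As A_M has degree
      at most M - m <= m + 1 <= j, the coefficient is exactly proportional to
      r^j: on the states above m, the vector (r^i) is a left eigenvector of the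
      matrix, with eigenvalue r A_M(1 / r), and this is lambda_sym.
    - For r < s < 1 the pole is at 1 / t with t < s, so the column sums are
      O(t^j) and thus below any multiple of s^j for large j. This makes (s^i) a
      Lyapunov function for the matrix, relatively to (r^i).

    A positive left eigenvector w bounds the powers of the matrix above by
    lambda^n. The Lyapunov function confines a fixed share of the mass
    w P^n = lambda^n w to finitely many rows, whence a lower bound of the same
    order when the entries are positive
    (lemma spectral_radius_left_eigenvector).

    It remains to see that a single class other than {0} occurs. Let N be the
    number of null cookies, so that N >= m. From a state i > N the cookies may be
    exhausted before the failure number i, and any number of ones may follow: the
    row i is positive. From a state 0 < i <= N the failure number i occurs among
    the cookies; the next state is in {0, ..., m}, and the one after it is 0. So
    the class is {i > N}, and the rows 0 < i <= N do not contribute to the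
    columns j > N of the identities above. *)

(** * Sums of non-negative extended reals over sets of naturals *)

Lemma esum_nneseries (R : realType) (S : set nat) (a : nat -> \bar R) :
  (forall i, S i -> 0 <= a i)%E ->
  (\esum_(i in S) a i = \sum_(i <oo | i \in S) a i)%E.
Proof.
move=> a0; rewrite nneseries_esum; first by rewrite set_mem_set.
by move=> n; rewrite inE; exact: a0.
Qed.

Lemma esumZl (R : realType) (S : set nat) (c : R) (a : nat -> \bar R) :
  0 <= c -> (forall i, S i -> 0 <= a i)%E ->
  (\esum_(i in S) (c%:E * a i) = c%:E * \esum_(i in S) a i)%E.
Proof.
move=> c0 a0; rewrite !esum_nneseries//.
  by rewrite nneseriesZl// => i; rewrite inE; exact: a0.
by move=> i Si; rewrite mule_ge0// ?lee_fin// a0.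
Qed.

Lemma esum_exchange (R : realType) (S S' : set nat) (a : nat -> nat -> \bar R) :
  (forall i k, 0 <= a i k)%E ->
  (\esum_(i in S) \esum_(k in S') a i k = \esum_(k in S') \esum_(i in S) a i k)%E.
Proof.
move=> a0; rewrite !esum_nneseries; try by move=> *; exact: esum_ge0.
under eq_eseriesr do rewrite esum_nneseries//.
under [RHS]eq_eseriesr do rewrite esum_nneseries//.
exact: nneseries_interchange.
Qed.

Lemma esum_ge_term (R : realType) (S : set nat) (a : nat -> \bar R) i :
  (forall i, S i -> 0 <= a i)%E -> S i -> (a i <= \esum_(k in S) a k)%E.
Proof.
move=> a0 Si; apply: esum_ge; exists [set i]; last by rewrite fsbig_set1.
by split => // x ->.
Qed.

Lemma subset_le_esum (R : realType) (A B : set nat) (a : nat -> \bar R) :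
  A `<=` B -> (forall i, B i -> 0 <= a i)%E ->
  (\esum_(i in A) a i <= \esum_(i in B) a i)%E.
Proof.
move=> AB a0; rewrite (esumID A B)//.
have -> : B `&` A = A by apply/setIidPr.
by rewrite leeDl// esum_ge0// => i [/a0].
Qed.

(** * Powers of a non-negative matrix weighted by a row vector *)

Lemma submx_pow_ge0 (R : realType) (Q : nat -> nat -> \bar R) (S : set nat) :
  (forall i j, 0 <= Q i j)%E -> forall n i j, (0 <= submx_pow Q S n i j)%E.
Proof.
move=> Q0; elim=> [|n IH] i j /=; first by rewrite lee_fin.
by apply: esum_ge0 => k _; rewrite mule_ge0.
Qed.

Lemma weighted_submx_pow0 (R : realType) (Q : nat -> nat -> \bar R)
    (S : set nat) (V : nat -> R) j : (forall i, 0 <= V i) -> S j ->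
  (\esum_(i in S) ((V i)%:E * submx_pow Q S 0 i j) = (V j)%:E)%E.
Proof.
move=> V0 Sj; rewrite (esumID [set j]); last first.
  by move=> i _ /=; rewrite mule_ge0// lee_fin.
have -> : S `&` [set j] = [set j] by apply/seteqP; split => x => [[]|->].
rewrite esum_set1/= ?eqxx ?mule1 ?lee_fin// esum1 ?adde0// => i [_ /= /eqP/negPf ->].
by rewrite mule0.
Qed.

(** The recursion defining the powers multiplies by Q on the left, so a row
    vector V is pushed through the first factor. The remaining power
    factors out of the inner sum because it is finite. *)
Lemma weighted_submx_powS (R : realType) (Q : nat -> nat -> \bar R)
    (S : set nat) (V : nat -> R) n j : (forall i j, 0 <= Q i j)%E ->
  (forall i, 0 <= V i) ->
  (forall k, S k -> submx_pow Q S n k j \is a fin_num) ->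
  (\esum_(i in S) ((V i)%:E * submx_pow Q S n.+1 i j) =
   \esum_(k in S) ((\esum_(i in S) ((V i)%:E * Q i k)) * submx_pow Q S n k j))%E.
Proof.
move=> Q0 V0 fin /=.
have P0 := @submx_pow_ge0 R Q S Q0.
under eq_esum => i Si.
  rewrite -esumZl//; first over.
  by move=> k _; rewrite mule_ge0.
rewrite esum_exchange; last by move=> *; rewrite !mule_ge0 ?lee_fin.
apply: eq_esum => k Sk; rewrite -(fineK (fin k Sk)) muleC -esumZl//.
- by apply: eq_esum => i Si; rewrite muleA muleC.
- by rewrite fine_ge0.
- by move=> i _; rewrite mule_ge0 ?lee_fin.
Qed.

(** * Positive left eigenvectors and spectral radius *)

Section left_eigenvector.
Variables (R : realType) (Q : nat -> nat -> \bar R) (S : set nat).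
Hypothesis Q0 : forall i j, (0 <= Q i j)%E.
Variables (lam : R) (w : nat -> R).
Hypothesis lam0 : 0 < lam.
Hypothesis w0 : forall i, 0 < w i.
Hypothesis wQ : forall k, S k ->
  (\esum_(i in S) ((w i)%:E * Q i k) = (lam * w k)%:E)%E.

(** A finite weighted sum has finite terms, and the weights are positive. *)
Lemma submx_pow_fin (x : R) n k j :
  (\esum_(i in S) ((w i)%:E * submx_pow Q S n i j) = x%:E)%E -> S k ->
  submx_pow Q S n k j \is a fin_num.
Proof.
move=> e Sk; have P0 := @submx_pow_ge0 R Q S Q0.
rewrite ge0_fin_numE//.
have : ((w k)%:E * submx_pow Q S n k j <= x%:E)%E.
  rewrite -e; apply: (@esum_ge_term _ _ (fun i => (w i)%:E * submx_pow Q S n i j)%E)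
    => // i _.
  by rewrite mule_ge0// lee_fin ltW.
case: (submx_pow Q S n k j) => [y|//|//] //=; first by rewrite ltry.
by rewrite gt0_muley ?lte_fin// leye_eq.
Qed.

Lemma left_eigenvector_pow n j : S j ->
  (\esum_(i in S) ((w i)%:E * submx_pow Q S n i j) = (lam ^+ n * w j)%:E)%E.
Proof.
move=> Sj; elim: n => [|n IH].
  by rewrite weighted_submx_pow0 ?expr0 ?mul1r// => i; exact: ltW.
rewrite weighted_submx_powS//; last 2 first.
- by move=> i; exact: ltW.
- by move=> k Sk; exact: submx_pow_fin IH Sk.
under eq_esum => k Sk do rewrite wQ// EFinM -muleA.
rewrite esumZl ?IH ?ltW//; first by rewrite -EFinM mulrA -exprS.
by move=> i _; rewrite mule_ge0 ?submx_pow_ge0// lee_fin ltW.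
Qed.

Lemma submx_pow_fin_num n k j : S k -> S j -> submx_pow Q S n k j \is a fin_num.
Proof. by move=> Sk Sj; exact: submx_pow_fin (left_eigenvector_pow n j Sj) Sk. Qed.

Lemma submx_pow_le n i j : S i -> S j ->
  (submx_pow Q S n i j <= (lam ^+ n * (w j / w i))%:E)%E.
Proof.
move=> Si Sj.
have := submx_pow_fin_num n i j Si Sj.
have : ((w i)%:E * submx_pow Q S n i j <= (lam ^+ n * w j)%:E)%E.
  rewrite -left_eigenvector_pow//.
  apply: (@esum_ge_term _ _ (fun i => (w i)%:E * submx_pow Q S n i j)%E)
    => // k _.
  by rewrite mule_ge0 ?submx_pow_ge0// lee_fin ltW.
case: (submx_pow Q S n i j) => [y|//|//]; rewrite -EFinM !lee_fin => h _.
by rewrite mulrA ler_pdivlMr// mulrC.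
Qed.

Variables (V : nat -> R) (eps K : R).
Hypothesis V0 : forall i, 0 < V i.
Hypothesis eps0 : 0 <= eps.
Hypothesis eps_lam : eps < lam.
Hypothesis K0 : 0 <= K.
Hypothesis VQ : forall k, S k ->
  (\esum_(i in S) ((V i)%:E * Q i k) <= (eps * V k + K * w k)%:E)%E.

(** The drift inequality y_(n+1) <= eps y_n + K lam^n w_j has solutions of order
    lam^n because eps < lam. *)
Lemma lyapunov_pow j : S j -> exists2 B : R, 0 < B & forall n,
  (\esum_(i in S) ((V i)%:E * submx_pow Q S n i j) <= (B * lam ^+ n)%:E)%E.
Proof.
(* The fixed point of the recursion for y_n / lam^n, plus the initial value. *)
move=> Sj; pose B := V j + K * w j / (lam - eps).
have d0 : 0 < lam - eps by rewrite subr_gt0.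
have Kw : 0 <= K * w j by rewrite mulr_ge0// ltW.
exists B; first by rewrite ltr_pwDl// divr_ge0// ltW.
have P0 := @submx_pow_ge0 R Q S Q0.
elim=> [|n IH].
  rewrite weighted_submx_pow0//; last by move=> i; exact: ltW.
  by rewrite lee_fin expr0 mulr1 lerDl divr_ge0// ltW.
rewrite weighted_submx_powS//; last 2 first.
- by move=> i; exact: ltW.
- by move=> k Sk; exact: submx_pow_fin_num.
apply: (@le_trans _ _ (\esum_(k in S) (eps%:E * ((V k)%:E * submx_pow Q S n k j) +
    K%:E * ((w k)%:E * submx_pow Q S n k j)))%E).
  apply: le_esum => k Sk; rewrite !muleA -!EFinM -ge0_muleDl ?lee_fin ?mulr_ge0
    ?(ltW (V0 _)) ?(ltW (w0 _))//.
  by rewrite -EFinD lee_wpmul2r// VQ.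
have nn U i : (forall i, 0 < U i) -> (0 <= (U i : R)%:E * submx_pow Q S n i j)%E.
  by move=> U0; rewrite mule_ge0// lee_fin ltW.
rewrite esumD; try by move=> i Si; apply: mule_ge0; [rewrite lee_fin|exact: nn].
rewrite !esumZl//; try by move=> i Si; exact: nn.
rewrite left_eigenvector_pow//.
apply: (@le_trans _ _ (eps%:E * (B * lam ^+ n)%:E + K%:E * (lam ^+ n * w j)%:E)%E).
  by rewrite leeD2r// lee_wpmul2l// lee_fin.
rewrite -!EFinM -EFinD lee_fin exprS.
have -> : eps * (B * lam ^+ n) + K * (lam ^+ n * w j) =
    (eps * B + K * w j) * lam ^+ n by ring.
rewrite mulrA ler_wpM2r ?exprn_ge0 ?(ltW lam0)//.
have -> : K * w j = (B - V j) * (lam - eps) by rewrite /B addrC addKr divfK// gt_eqF.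
rewrite -subr_ge0.
have -> : B * lam - (eps * B + (B - V j) * (lam - eps)) = V j * (lam - eps) by ring.
by rewrite mulr_ge0// ltW.
Qed.

Hypothesis w_small : forall eta : R, 0 < eta ->
  exists N, forall i, (N <= i)%N -> w i <= eta * V i.

(** The weighted mass lam^n w_j of the column j of the n-th power cannot escape
    to infinity: its part beyond N is at most eta times the V-mass, of the same
    order lam^n, and eta is chosen so that half of the mass remains. *)
Lemma truncated_mass_ge j : S j -> exists N : nat, forall n,
  ((lam ^+ n * (w j / 2))%:E <=
   \esum_(i in S `&` [set i | (i < N)%N]) ((w i)%:E * submx_pow Q S n i j))%E.
Proof.
move=> Sj; have P0 := @submx_pow_ge0 R Q S Q0.
have [B B0 hB] := lyapunov_pow j Sj.
have eta0 : 0 < w j / 2 / B by rewrite !divr_gt0.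
have [N hN] := w_small _ eta0.
exists N => n.
have nn i : (0 <= (w i)%:E * submx_pow Q S n i j)%E.
  by rewrite mule_ge0// lee_fin ltW.
have tail : (\esum_(i in S `&` ~` [set i | (i < N)%N])
    ((w i)%:E * submx_pow Q S n i j) <= (lam ^+ n * (w j / 2))%:E)%E.
  apply: (@le_trans _ _ (\esum_(i in S `&` ~` [set i | (i < N)%N])
      ((w j / 2 / B)%:E * ((V i)%:E * submx_pow Q S n i j)))%E).
    apply: le_esum => i [Si /= /negP]; rewrite -leqNgt => Ni.
    by rewrite muleA -EFinM lee_wpmul2r// lee_fin hN.
  rewrite esumZl ?(ltW eta0)//; last first.
    by move=> i _; rewrite mule_ge0// lee_fin ltW.
  apply: (@le_trans _ _ ((w j / 2 / B)%:E * (B * lam ^+ n)%:E)%E); last first.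
    by rewrite -EFinM lee_fin (mulrC _ (w j / 2)) mulrA divfK// gt_eqF.
  rewrite lee_wpmul2l ?lee_fin ?(ltW eta0)//.
  apply: le_trans (hB n); apply: subset_le_esum; first by move=> ? [].
  by move=> i _; rewrite mule_ge0// lee_fin ltW.
have := left_eigenvector_pow n j Sj.
rewrite (esumID [set i | (i < N)%N])//.
move: tail; case: (esum _ _) => [x|//|]; last by move=> _; case: (esum _ _).
rewrite lee_fin.
case: (esum _ _) => [y|//|//] hx [] h.
by rewrite lee_fin; lra.
Qed.

Hypothesis Qpos : forall i j, S i -> S j -> (0 < Q i j)%E.

Lemma dominate_finite (i N : nat) : S i -> exists2 c : R, 0 < c &
  forall k, S k -> (k < N)%N -> ((c * w k)%:E <= Q i k)%E.
Proof.
move=> Si; elim: N => [|N [c c0 IH]]; first by exists 1.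
have [SN|SN] := pselect (S N); last first.
  exists c => // k Sk; rewrite ltnS leq_eqVlt => /predU1P[kN|kN]; last exact: IH.
  by case: SN; rewrite -kN.
have [e e0 he] : exists2 e : R, 0 < e & (e%:E <= Q i N)%E.
  have := Qpos i N Si SN; case: (Q i N) => [x|_|//]; last by exists 1; rewrite ?leey.
  by rewrite lte_fin => x0; exists x.
exists (Num.min c (e / w N)).
  by rewrite lt_min c0 divr_gt0.
move=> k Sk; rewrite ltnS leq_eqVlt => /predU1P[->|kN].
  apply: le_trans he; rewrite lee_fin -ler_pdivlMr//.
  by rewrite ge_min lexx orbT.
apply: le_trans (IH k Sk kN); rewrite lee_fin ler_wpM2r ?(ltW (w0 _))//.
by rewrite ge_min lexx.
Qed.

(** One step from i reaches the finitely many rows that carry half of the mass,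
    with entries bounded below by a multiple of w. *)
Lemma submx_pow_ge i j : S i -> S j -> exists2 c : R, 0 < c & forall n,
  ((c * lam ^+ n.+1)%:E <= submx_pow Q S n.+1 i j)%E.
Proof.
move=> Si Sj; have P0 := @submx_pow_ge0 R Q S Q0.
have [N hN] := truncated_mass_ge j Sj.
have [c c0 hc] := dominate_finite i N Si.
exists (c * (w j / 2) / lam); first by rewrite !(divr_gt0, mulr_gt0).
move=> n /=.
apply: (@le_trans _ _ (\esum_(k in S `&` [set k | (k < N)%N])
   (Q i k * submx_pow Q S n k j))%E); last first.
  apply: subset_le_esum; first by move=> ? [].
  by move=> k _; rewrite mule_ge0.
apply: (@le_trans _ _ (c%:E * (lam ^+ n * (w j / 2))%:E)%E).
  rewrite -EFinM lee_fin exprS le_eqVlt; apply/orP; left; apply/eqP.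
  by field; rewrite gt_eqF.
apply: (@le_trans _ _ (\esum_(k in S `&` [set k | (k < N)%N])
   (c%:E * ((w k)%:E * submx_pow Q S n k j)))%E).
  rewrite esumZl ?(ltW c0)// ?lee_wpmul2l ?lee_fin ?(ltW c0)//.
  by move=> k _; rewrite mule_ge0// lee_fin ltW.
apply: le_esum => k [Sk kN].
by rewrite muleA -EFinM lee_wpmul2r// hc.
Qed.

Lemma cvg_powR_invn (c : R) :
  0 < c -> (fun n : nat => c `^ n%:R^-1) @ \oo --> (1 : R).
Proof.
move=> c0; rewrite /powR gt_eqF//.
rewrite -[X in _ --> X]expR0.
apply: (@continuous_cvg _ _ _ _ _ _ expR); first exact: continuous_expR.
rewrite -[X in _ --> X](mul0r (ln c)).
apply: cvgMr_tmp.
rewrite -cvg_shiftS; exact: cvg_harmonic.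
Qed.

(** Both bounds on the powers are constants times lam^n, and the n-th roots of
    the constants tend to 1. *)
Lemma spectral_radius_left_eigenvector : is_spectral_radius Q S lam%:E.
Proof.
move=> i j Si Sj.
have [c c0 hc] := submx_pow_ge i j Si Sj.
have C0 : 0 < w j / w i by rewrite divr_gt0.
have lim C : 0 < C ->
    (fun n : nat => ((C * lam ^+ n) `^ n%:R^-1)%:E) @ \oo --> lam%:E.
  move=> C0'; apply: cvg_EFin; first by apply: nearW.
  have : (fun n : nat => C `^ n%:R^-1 * lam) @ \oo --> 1 * lam.
    by apply: cvgMr_tmp; exact: cvg_powR_invn.
  rewrite mul1r; apply: cvg_trans; apply: near_eq_cvg; near=> n => /=.
  rewrite powRM ?exprn_ge0 ?(ltW lam0) ?(ltW C0')// -powR_mulrn ?(ltW lam0)//.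
  rewrite -powRrM mulfV ?powRr1 ?(ltW lam0)//.
  by rewrite pnatr_eq0 -lt0n; near: n; exact: nbhs_infty_gt.
apply: (squeeze_cvge _ (lim _ c0) (lim _ C0)).
near=> n.
have n0 : (0 < n)%N by near: n; exact: nbhs_infty_gt.
have /fineK <- := submx_pow_fin_num n i j Si Sj.
have f0 : 0 <= fine (submx_pow Q S n i j) by rewrite fine_ge0// submx_pow_ge0.
have lo : c * lam ^+ n <= fine (submx_pow Q S n i j).
  rewrite -lee_fin fineK; last exact: submx_pow_fin_num.
  by move: (hc n.-1); rewrite prednK.
have hi : fine (submx_pow Q S n i j) <= w j / w i * lam ^+ n.
  rewrite -lee_fin fineK; last exact: submx_pow_fin_num.
  by rewrite mulrC submx_pow_le.
rewrite poweR_EFin !lee_fin; apply/andP; split; apply: ge0_ler_powR => //;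
  rewrite ?nnegrE ?invr_ge0// mulr_ge0 ?exprn_ge0 ?ltW//.
Unshelve. all: by end_near.
Qed.

End left_eigenvector.

(** * Counting failures and ones *)

(** The partial sums satisfy the same affine equation as x up to a term of the
    right sign, so they stay below x. The sum of the series is then finite, and
    the equation that it satisfies has x as its only real solution. *)
Lemma geometric_recurrence_series (R : realType) (f g : nat -> R)
    (al be x z : R) :
  (forall k, 0 <= f k) -> (forall k, 0 <= g k) ->
  0 <= al < 1 -> 0 <= be ->
  (forall k, f k.+1 = al * f k + be * g k) ->
  (\sum_(k <oo) (g k)%:E = z%:E)%E -> (1 - al) * x = f 0%N + be * z ->
  (\sum_(k <oo) (f k)%:E = x%:E)%E.
Proof.
move=> f0 g0 /andP[al0 al1] be0 fS gz xE.
have gpart N : \sum_(k < N) g k <= z.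
  rewrite -lee_fin -gz -sumEFin -(big_mkord xpredT (fun k => (g k)%:E)).
  by apply: nneseries_lim_ge => k _ _; rewrite lee_fin.
have fpart N : (1 - al) * (\sum_(k < N) f k) = f 0%N - f N + be * (\sum_(k < N) g k).
  elim: N => [|N IH]; first by rewrite !big_ord0 !mulr0 subrr addr0.
  rewrite !big_ord_recr/= mulrDr IH fS; ring.
have fle N : \sum_(k < N) f k <= x.
  rewrite -(ler_pM2l (_ : 0 < 1 - al)) ?subr_gt0// fpart xE lerD ?ler_wpM2l//.
  by rewrite lerBlDr lerDl.
have : (\sum_(k <oo) (f k)%:E <= x%:E)%E.
  apply: lime_le; first by apply: is_cvg_nneseries => k _ _; rewrite lee_fin.
  by apply: nearW => N; rewrite big_mkord sumEFin lee_fin.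
have : (0 <= \sum_(k <oo) (f k)%:E)%E.
  by apply: nneseries_ge0 => k _ _; rewrite lee_fin.
have : (\sum_(k <oo) (f k)%:E =
    (f 0%N)%:E + (al%:E * \sum_(k <oo) (f k)%:E + be%:E * \sum_(k <oo) (g k)%:E))%E.
  rewrite {1}nneseries_recl//; last by move=> k _; rewrite lee_fin.
  congr (_ + _)%E; rewrite -nneseries_addn; last by move=> k; rewrite lee_fin.
  rewrite -!nneseriesZl; try by move=> k _; rewrite lee_fin.
  rewrite -nneseriesD; try by move=> k _ _; rewrite -EFinM lee_fin mulr_ge0.
  by apply: eq_eseriesr => k _; rewrite addn1 fS EFinD !EFinM.
rewrite gz; case: (\sum_(k <oo) _)%E => [y|//|//] [yE] _ _.
congr (_%:E); apply: (mulfI (_ : 1 - al != 0)); first by rewrite subr_eq0 gt_eqF.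
by rewrite xE mulrBl mul1r {1}yE; ring.
Qed.

(** Probability that f failures and o ones occur among the first n trials, the
    trials being independent of strengths c. *)
Fixpoint count_prob {R : realType} (c : nat -> R) (b n f o : nat) : R :=
  if n is n'.+1 then
    (1 - c n') * (if f is f'.+1 then count_prob c b n' f' o else 0)
    + c n' / b%:R * (if o is o'.+1 then count_prob c b n' f o' else 0)
    + c n' * (b%:R - 1) / b%:R * count_prob c b n' f o
  else ((f == 0%N) && (o == 0%N))%:R.

(** Generating polynomial of the number of ones among the first n trials, each
    failure being given the weight s. *)
Definition count_poly {R : realType} (c : nat -> R) (b : nat) (s : R) (n : nat)
    : {poly R} :=
  \prod_(l < n) (((1 - c l) * s + (b%:R - 1) * c l / b%:R)%:P
                 + (c l / b%:R) *: 'X).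

Section counts.
Variables (R : realType) (c : nat -> R) (b : nat).

Lemma count_prob_eq0 n f o : (n < f + o)%N -> count_prob c b n f o = 0.
Proof.
elim: n f o => [|n IH] f o /=; first by case: f; case: o.
move=> nfo; rewrite (IH f o) 1?ltnW// mulr0 addr0.
have -> : (if f is f'.+1 then count_prob c b n f' o else 0) = 0.
  by case: f nfo => // f nfo; apply: IH; lia.
have -> : (if o is o'.+1 then count_prob c b n f o' else 0) = 0.
  by case: o nfo => // o nfo; apply: IH; lia.
by rewrite !mulr0 addr0.
Qed.

Lemma count_poly_coefS s n j : (count_poly c b s n.+1)`_j =
  ((1 - c n) * s + (b%:R - 1) * c n / b%:R) * (count_poly c b s n)`_j
  + c n / b%:R * (if j is j'.+1 then (count_poly c b s n)`_j' else 0).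
Proof.
rewrite /count_poly big_ord_recr/= mulrDr coefD coefMC -scalerAr coefZ coefMX.
by rewrite mulrC; case: j.
Qed.

Lemma sum_count_prob s n N j : (n < N)%N ->
  \sum_(f < N) s ^+ f * count_prob c b n f j = (count_poly c b s n)`_j.
Proof.
elim: n N j => [|n IH] [//|N] j nN.
  rewrite big_ord_recl/= big1 => [|i _]; last by rewrite mulr0.
  by rewrite addr0 expr0 mul1r /count_poly big_ord0 coef1.
rewrite count_poly_coefS /=.
under eq_bigr do rewrite mulrDr mulrDr.
rewrite !big_split/=.
have -> : \sum_(i < N.+1) s ^+ i *
    ((1 - c n) * (if nat_of_ord i is f'.+1 then count_prob c b n f' j else 0)) =
    (1 - c n) * s * (count_poly c b s n)`_j.
  rewrite big_ord_recl/= !mulr0 add0r -(IH N)// big_distrr/=.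
  by apply: eq_bigr => i _; rewrite exprS; ring.
have -> : \sum_(i < N.+1) s ^+ i *
    (c n / b%:R * (if j is o'.+1 then count_prob c b n i o' else 0)) =
    c n / b%:R * (if j is j'.+1 then (count_poly c b s n)`_j' else 0).
  case: j => [|j]; first by rewrite big1 ?mulr0// => i _; rewrite !mulr0.
  rewrite -(IH N.+1) 1?ltnW// big_distrr/=.
  by apply: eq_bigr => i _; ring.
have -> : \sum_(i < N.+1) s ^+ i *
    (c n * (b%:R - 1) / b%:R * count_prob c b n i j) =
    (b%:R - 1) * c n / b%:R * (count_poly c b s n)`_j.
  rewrite -(IH N.+1) 1?ltnW// big_distrr/=.
  by apply: eq_bigr => i _; ring.
by rewrite [in RHS]mulrDl addrAC.
Qed.

(** A trial with a null cookie never yields a one. *)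
Lemma count_poly_coef_eq0 s m n j : (forall l, (l < m)%N -> c l = 0) ->
  (n - m < j)%N -> (count_poly c b s n)`_j = 0.
Proof.
move=> cm; elim: n j => [|n IH] j nmj.
  by rewrite /count_poly big_ord0 coef1; case: j nmj.
rewrite count_poly_coefS IH ?mulr0 ?add0r; last by lia.
case: j nmj => [|j] nmj; first by rewrite mulr0.
have [nm|mn] := ltnP n m; first by rewrite cm// !mul0r.
by rewrite IH ?mulr0//; lia.
Qed.

Hypothesis c01 : forall n, 0 <= c n < 1.
Hypothesis b1 : (0 < b)%N.

Local Lemma c_ge0 n : 0 <= c n. Proof. by have /andP[] := c01 n. Qed.
Local Lemma c_lt1 n : 0 < 1 - c n.
Proof. by have /andP[] := c01 n; rewrite subr_gt0. Qed.
Local Lemma b_gt0 : 0 < b%:R :> R. Proof. by rewrite ltr0n. Qed.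
Local Lemma b_ge1 : 0 <= b%:R - 1 :> R. Proof. by rewrite subr_ge0 ler1n. Qed.

Lemma count_prob_ge0 n f o : 0 <= count_prob c b n f o.
Proof.
elim: n f o => [|n IH] f o /=; first by rewrite ler0n.
have := c_ge0 n; have := ltW (c_lt1 n); have := b_ge1; have := ltW b_gt0 => *.
by rewrite !addr_ge0// !mulr_ge0 ?invr_ge0//; [case: f|case: o].
Qed.

Lemma count_poly_ge0 (s : R) n j : 0 <= s -> 0 <= (count_poly c b s n)`_j.
Proof.
move=> s0; rewrite -(@sum_count_prob s n n.+1)// sumr_ge0// => i _.
by rewrite mulr_ge0 ?exprn_ge0 ?count_prob_ge0.
Qed.

Variables (M : nat) (q : R).
Hypothesis cM : forall n, (M <= n)%N -> c n = q.

(** Beyond the index M all factors are the same linear polynomial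
    al + (q / b) Y, so the sum is the expansion of A_M / (1 - al - (q / b) Y),
    whose coefficients x obey a two-term recurrence. *)
Lemma count_poly_series (s : R) (x : nat -> R) : 0 <= s < 1 ->
  let al := (1 - q) * s + (b%:R - 1) * q / b%:R in
  (1 - al) * x 0%N = (count_poly c b s M)`_0 ->
  (forall j, (1 - al) * x j.+1 = (count_poly c b s M)`_j.+1 + q / b%:R * x j) ->
  forall j, (\sum_(k <oo) ((count_poly c b s (M + k))`_j)%:E = (x j)%:E)%E.
Proof.
move=> /andP[s0 s1] al x0 xS.
have q0 : 0 <= q by rewrite -(cM M (leqnn M)) c_ge0.
have q1 : 0 < 1 - q by rewrite -(cM M (leqnn M)) c_lt1.
have al0 : 0 <= al.
  by rewrite addr_ge0 ?mulr_ge0 ?invr_ge0 ?b_ge1 ?(ltW q1) ?(ltW b_gt0).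
have al1 : al < 1.
  have h : (b%:R - 1) * q / b%:R <= q.
    by rewrite ler_pdivrMr ?b_gt0// mulrC ler_wpM2l// lerBlDr lerDl.
  have h2 : (1 - q) * s < 1 - q by rewrite gtr_pMr.
  by rewrite /al; lra.
elim=> [|j IH].
- apply: (@geometric_recurrence_series _ _ (fun=> 0) al (q / b%:R) _ 0) => //.
  + by move=> k; exact: count_poly_ge0.
  + by rewrite al0.
  + by rewrite divr_ge0 ?(ltW b_gt0).
  + by move=> k; rewrite addnS count_poly_coefS cM ?leq_addr.
  + by rewrite eseries0.
  + by rewrite addn0 mulr0 addr0.
- apply: (@geometric_recurrence_series _ _
      (fun k => (count_poly c b s (M + k))`_j) al (q / b%:R) _ (x j)) => //.
  + by move=> k; exact: count_poly_ge0.
  + by move=> k; exact: count_poly_ge0.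
  + by rewrite al0.
  + by rewrite divr_ge0 ?(ltW b_gt0).
  + by move=> k; rewrite addnS count_poly_coefS cM ?leq_addr.
  + by rewrite addn0 xS.
Qed.

(** Exchanging the sums over i and n turns the sum over i into a coefficient of
    the generating polynomial. The terms n < M vanish for degree reasons. *)
Lemma weighted_column (s : R) m j : 0 <= s < 1 ->
  (forall l, (l < m)%N -> c l = 0) ->
  (M.-1 - m < j)%N ->
  (\sum_(i <oo) ((s ^+ i.+1)%:E *
     \sum_(n <oo) (count_prob c b n i j * (1 - c n))%:E) =
   (s * (1 - q))%:E * \sum_(k <oo) ((count_poly c b s (M + k))`_j)%:E)%E.
Proof.
move=> /andP[s0 s1] cm mj.
have nn n i : (0 <= (s ^+ i.+1)%:E * (count_prob c b n i j * (1 - c n))%:E)%E.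
  by rewrite -EFinM lee_fin !mulr_ge0 ?exprn_ge0 ?count_prob_ge0 ?(ltW (c_lt1 n)).
have q1 : 0 < 1 - q by rewrite -(cM M (leqnn M)) c_lt1.
under eq_eseriesr => i _.
  rewrite -nneseriesZl; last first.
    by move=> n _; rewrite lee_fin mulr_ge0 ?count_prob_ge0// ltW// c_lt1.
  over.
rewrite nneseries_interchange//.
have inner n :
    (\sum_(i <oo) ((s ^+ i.+1)%:E * (count_prob c b n i j * (1 - c n))%:E)
    = (s * (1 - c n) * (count_poly c b s n)`_j)%:E)%E.
  rewrite (@nneseries_split _ _ 0 n.+1)// add0n eseries0 ?adde0; last first.
    by move=> i ni _; rewrite count_prob_eq0 ?mul0r ?mule0//; lia.
  rewrite big_mkord -(@sum_count_prob s n n.+1)// big_distrr/= -sumEFin.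
  by apply: eq_bigr => i _; rewrite -EFinM exprS; congr (_%:E); ring.
under eq_eseriesr do rewrite inner.
rewrite (@nneseries_split _ _ 0 M); last first.
  by move=> n _; rewrite lee_fin !mulr_ge0 ?count_poly_ge0// ltW// c_lt1.
rewrite big_mkord big1 ?add0e; last first.
  by move=> n _; rewrite (@count_poly_coef_eq0 s m) ?mulr0//; have := ltn_ord n; lia.
rewrite -nneseries_addn; last first.
  by move=> n; rewrite lee_fin !mulr_ge0 ?count_poly_ge0// ltW// c_lt1.
rewrite -nneseriesZl; last by move=> k _; rewrite lee_fin count_poly_ge0.
by apply: eq_eseriesr => k _; rewrite cM ?leq_addl// addnC EFinM.
Qed.

End counts.

(** * The cookie matrix in terms of the law of the counts *)

Lemma occurrencesS (x : nat -> nat) v n :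
  occurrences x v n.+1 = (occurrences x v n + (x n == v))%N.
Proof. by rewrite /occurrences big_ord_recr. Qed.

Lemma occurrences_lt (x : nat -> nat) v n m :
  (n < m)%N -> x n = v -> (occurrences x v n < occurrences x v m)%N.
Proof.
move=> nm xn; elim: m nm => // m IH; rewrite ltnS leq_eqVlt occurrencesS.
by move=> /predU1P[<-|/IH]; rewrite ?xn ?eqxx ?addn1//; lia.
Qed.

Section cookie_counts.
Variables (R : realType) (d : measure_display) (T : measurableType d)
  (Pr : probability T R) (xi : nat -> {RV Pr >-> nat}) (c : nat -> R) (b : nat).
Hypothesis b1 : (0 < b)%N.
Hypothesis xi_indep : mutually_independent xi.
Hypothesis xi0 : forall n, Pr (xi n @^-1` [set 0%N]) = (1 - c n)%:E.
Hypothesis xi1 : forall n, Pr (xi n @^-1` [set 1%N]) = (c n / b%:R)%:E.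

Definition counts_event n f o : set T :=
  [set w | occurrences (fun l => xi l w) 0 n = f /\
           occurrences (fun l => xi l w) 1 n = o].

Definition cylinder (J : seq nat) (B : nat -> set nat) : set T :=
  [set w | forall l, l \in J -> B l (xi l w)].

Lemma measurable_xi n (B : set nat) : measurable (xi n @^-1` B).
Proof. exact: measurable_funPTI. Qed.

Lemma measurable_cylinder J B : measurable (cylinder J B).
Proof.
have -> : cylinder J B = \bigcap_l (if l \in J then xi l @^-1` B l else setT).
  apply/seteqP; split => w /= h l; first by move=> _; case: ifP => // /h.
  by move=> lJ; have := h l I; rewrite lJ.
by apply: bigcapT_measurable => l; case: ifP => // _; exact: measurable_xi.
Qed.

Lemma counts_eventS n f o : counts_event n.+1 f o =
  (if f is f'.+1 then counts_event n f' o `&` xi n @^-1` [set 0%N] else set0)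
  `|` ((if o is o'.+1 then counts_event n f o' `&` xi n @^-1` [set 1%N] else set0)
  `|` (counts_event n f o `&` xi n @^-1` ~` [set 0%N; 1%N])).
Proof.
apply/seteqP; split => w.
- rewrite /counts_event /= !occurrencesS.
  case: (eqVneq (xi n w) 0%N) => [x0|x0].
    by rewrite x0 addn0 addn1 => -[<- <-]; left.
  case: (eqVneq (xi n w) 1%N) => [x1|x1].
    by rewrite addn0 addn1 => -[<- <-]; right; left.
  by rewrite !addn0 => h; right; right; split => // -[]; apply/eqP.
- rewrite /counts_event /= !occurrencesS => -[|[|]].
  + by case: f => [//|f] [[<- <-] ->]; rewrite addn0 addn1.
  + by case: o => [//|o] [[<- <-] ->]; rewrite addn0 addn1.
  + move=> [[-> ->]] h.
    have /negPf -> : xi n w != 0%N by apply/eqP => x0; apply: h; left.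
    have /negPf -> : xi n w != 1%N by apply/eqP => x1; apply: h; right.
    by rewrite !addn0.
Qed.

Lemma measurable_counts_event n f o : measurable (counts_event n f o).
Proof.
elim: n f o => [|n IH] f o.
  have [[-> ->]|h] := pselect (f = 0%N /\ o = 0%N).
    rewrite (_ : counts_event _ _ _ = setT)//; apply/seteqP; split => // w _.
    by rewrite /counts_event/= /occurrences !big_ord0.
  rewrite (_ : counts_event _ _ _ = set0)//; apply/seteqP; split => // w.
  by rewrite /counts_event/= /occurrences !big_ord0 => -[f0 o0]; apply: h.
rewrite counts_eventS; apply: measurableU; last apply: measurableU.
- by case: f => // f; apply: measurableI => //; exact: measurable_xi.
- by case: o => // o; apply: measurableI => //; exact: measurable_xi.
- by apply: measurableI => //; exact: measurable_xi.
Qed.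

Lemma prob_other n :
  Pr (xi n @^-1` ~` [set 0%N; 1%N]) = (c n * (b%:R - 1) / b%:R)%:E.
Proof.
rewrite -preimage_setC probability_setC; last exact: measurable_xi.
have -> : xi n @^-1` [set 0%N; 1%N] = xi n @^-1` [set 0%N] `|` xi n @^-1` [set 1%N].
  by rewrite -preimage_setU.
rewrite measureU; [|exact: measurable_xi|exact: measurable_xi|]; last first.
  by apply/seteqP; split => // w /= [-> //].
have -> : (Pr (xi n @^-1` [set 0%N]) + Pr (xi n @^-1` [set 1%N]) =
    (1 - c n + c n / b%:R)%:E)%E.
  by rewrite xi0 xi1 -EFinD.
rewrite -EFinD; congr (_%:E).
by field; rewrite pnatr_eq0 -lt0n.
Qed.

(** Mutual independence is a product rule for cylinders only. Keeping an
    arbitrary cylinder over the indices from n on makes the induction on n go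
    through: the trial n, which decides the last increment of the counts, joins
    the cylinder. *)
Lemma counts_independent n f o (J : seq nat) (B : nat -> set nat) :
  uniq J -> (forall l, l \in J -> (n <= l)%N) ->
  Pr (counts_event n f o `&` cylinder J B) =
  ((count_prob c b n f o)%:E * \prod_(l <- J) Pr (xi l @^-1` B l))%E.
Proof.
elim: n f o J B => [|n IH] f o J B uJ nJ.
  rewrite /= -xi_indep//.
  have [[-> ->]|h] := pselect (f = 0%N /\ o = 0%N).
    rewrite /= mul1e; congr (Pr _); apply/seteqP; split => w; first by case.
    by move=> h; split => //; rewrite /counts_event/= /occurrences !big_ord0.
  have -> : (f == 0%N) && (o == 0%N) = false.
    by apply/negP => /andP[/eqP f0 /eqP o0]; apply: h.
  rewrite mul0e -[RHS](measure0 Pr); congr (Pr _); apply/seteqP; split => // w [].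
  by rewrite /counts_event/= /occurrences !big_ord0 => -[f0 o0]; case: h.
have step f' o' V : Pr ((counts_event n f' o' `&` xi n @^-1` V) `&` cylinder J B) =
    ((count_prob c b n f' o')%:E * (Pr (xi n @^-1` V) *
     \prod_(l <- J) Pr (xi l @^-1` B l)))%E.
  have nJ' : n \notin J by apply/negP => /nJ; rewrite ltnn.
  pose B' l := if l == n then V else B l.
  have eqB' l : l \in J -> B' l = B l.
    by move=> lJ; rewrite /B'; case: eqP => // ln; rewrite -ln lJ in nJ'.
  rewrite -setIA (_ : xi n @^-1` V `&` cylinder J B = cylinder (n :: J) B').
    rewrite IH/= ?nJ'//; last by move=> l; rewrite inE => /predU1P[->//|/nJ/ltnW].
    rewrite big_cons {1}/B' eqxx; congr (_ * (_ * _))%E.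
    by rewrite big_seq [RHS]big_seq; apply: eq_bigr => l /eqB' ->.
  apply/seteqP; split => w.
    move=> [Vw h] l; rewrite inE => /predU1P[->|lJ]; first by rewrite /B' eqxx.
    by rewrite eqB'//; exact: h.
  move=> h; split; first by have := h n; rewrite inE eqxx /B' eqxx; exact.
  by move=> l lJ; rewrite -eqB'//; apply: h; rewrite inE lJ orbT.
have mC := measurable_cylinder J B.
have mE f' o' V :
    measurable ((counts_event n f' o' `&` xi n @^-1` V) `&` cylinder J B).
  apply: measurableI => //; apply: measurableI; first exact: measurable_counts_event.
  exact: measurable_xi.
rewrite counts_eventS !setIUl measureU; last first.
- apply/seteqP; split => // w [[]].
  case: f => [//|f] [_ /= x0] _ [|].
    by case: o => [[]//|o] [[_ /=]]; rewrite x0.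
  by move=> [[_ /= h] _]; apply: h; left.
- by apply: measurableU; [case: o => [|o]; rewrite ?set0I//|].
- by case: f => [|f]; rewrite ?set0I.
rewrite measureU//; last first.
- apply/seteqP; split => // w [[]].
  by case: o => [//|o] [_ /= x0] _ [[_ /= h] _]; apply: h; right.
- by case: o => [|o]; rewrite ?set0I.
transitivity (((1 - c n) * (if f is f'.+1 then count_prob c b n f' o else 0))%:E *
     \prod_(l <- J) Pr (xi l @^-1` B l) +
   ((c n / b%:R * (if o is o'.+1 then count_prob c b n f o' else 0))%:E *
     \prod_(l <- J) Pr (xi l @^-1` B l) +
   (c n * (b%:R - 1) / b%:R * count_prob c b n f o)%:E *
     \prod_(l <- J) Pr (xi l @^-1` B l)))%E.
  congr (_ + (_ + _))%E.
  - case: f => [|f]; first by rewrite set0I measure0 mulr0 mul0e.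
    by apply: etrans (step _ _ _) _; rewrite xi0 muleA -EFinM mulrC.
  - case: o => [|o]; first by rewrite set0I measure0 mulr0 mul0e.
    by apply: etrans (step _ _ _) _; rewrite xi1 muleA -EFinM mulrC.
  - by apply: etrans (step _ _ _) _; rewrite prob_other muleA -EFinM mulrC.
have : (\prod_(l <- J) Pr (xi l @^-1` B l) \is a fin_num)%E.
  by apply: prode_fin_num => l _; apply: fin_num_measure; exact: measurable_xi.
by move=> /fineK <-; rewrite -!EFinM -!EFinD -!mulrDl addrA.
Qed.

(** The index of the failure number i + 1 is unique, so the event is a disjoint
    union over the possible indices. *)
Lemma cookie_matrixS i j : cookie_matrix xi i.+1 j =
  (\sum_(n <oo) (count_prob c b n i j * (1 - c n))%:E)%E.
Proof.
pose F n := counts_event n i j `&` xi n @^-1` [set 0%N].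
have mF n : measurable (F n).
  by apply: measurableI; [exact: measurable_counts_event|exact: measurable_xi].
rewrite /cookie_matrix (_ : [set w | _] = \bigcup_n F n); last first.
  apply/seteqP; split => w /=.
    by move=> [n [x0 [f o]]]; exists n.
  by move=> [n _ [[f o] x0]]; exists n; split => //; rewrite f.
rewrite measure_semi_bigcup//; last 2 first.
- apply/trivIsetP => n m _ _ nm; apply/seteqP; split => // w.
  move=> [[[fn _] xn] [[fm _] xm]].
  move: nm; rewrite neq_ltn => /orP[] lt.
    by have := occurrences_lt (fun l => xi l w) 0 n m lt xn; rewrite fn fm ltnn.
  by have := occurrences_lt (fun l => xi l w) 0 m n lt xm; rewrite fn fm ltnn.
- exact: bigcupT_measurable.
apply: eq_eseriesr => n _.
have -> : F n = counts_event n i j `&` cylinder [:: n] (fun=> [set 0%N]).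
  congr (_ `&` _); apply/seteqP; split => w /=.
    by move=> x0 l; rewrite inE => /eqP ->.
  by apply; rewrite inE.
apply: etrans (counts_independent _ _ _ _ _ _ _) _ => //.
  by move=> l; rewrite inE => /eqP ->.
by rewrite big_cons big_nil mule1 xi0 -EFinM.
Qed.

End cookie_counts.

(** * Irreducible classes *)

Lemma submx_powS_gt0 (R : realType) (Q : nat -> nat -> \bar R) (S : set nat)
    n i j : (forall i j, 0 <= Q i j)%E -> (0 < submx_pow Q S n.+1 i j)%E ->
  exists2 k, (0 < Q i k)%E & (0 < submx_pow Q S n k j)%E.
Proof.
move=> Q0 /=; apply: contraPP => h; apply/negP; rewrite -leNgt.
rewrite esum1// => k _; have [Qik|] := ltP 0%E (Q i k); last first.
  by move=> Qik; rewrite (_ : Q i k = 0%E) ?mul0e//; apply/eqP; rewrite eq_le Qik Q0.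
have [P|P] := ltP 0%E (submx_pow Q S n k j); first by case: h; exists k.
rewrite (_ : submx_pow Q S n k j = 0%E) ?mule0//.
by apply/eqP; rewrite eq_le P submx_pow_ge0.
Qed.

Lemma submx_pow_closed (R : realType) (Q : nat -> nat -> \bar R) (S A : set nat) :
  (forall i j, 0 <= Q i j)%E ->
  (forall i j, A i -> (0 < Q i j)%E -> A j) ->
  forall n i j, A i -> (0 < submx_pow Q S n i j)%E -> A j.
Proof.
move=> Q0 AQ; elim=> [|n IH] i j Ai.
  by rewrite /= lte_fin; case: eqP => [<-//|]; rewrite ltxx.
by move=> /(submx_powS_gt0 _ _ _ _ _ _ Q0) [k Qik]; apply: IH; exact: AQ Qik.
Qed.

(** The matrices considered below have three kinds of rows besides the row 0:
    those of index i > N are positive, those with i <= N lead into {0, ..., m},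
    and those with i <= m lead to 0. *)
Section classes.
Variables (R : realType) (Q : nat -> nat -> \bar R) (m N : nat).
Hypothesis Q0 : forall i j, (0 <= Q i j)%E.
Hypothesis Q0row : forall j, Q 0%N j = ((j == 0%N)%:R)%:E.
Hypothesis mN : (m <= N)%N.
Hypothesis Qpos : forall i j, (N < i)%N -> (0 < Q i j)%E.
Hypothesis Qmid : forall i j, (0 < i <= N)%N -> (m < j)%N -> Q i j = 0%E.
Hypothesis Qlow : forall i j, (0 < i <= m)%N -> (0 < j)%N -> Q i j = 0%E.

Lemma leads_to_high i j : (N < i)%N -> leads_to Q i j.
Proof.
move=> Ni; exists 1%N => //; apply: (@lt_le_trans _ _ (Q i j)); first exact: Qpos.
have := @esum_ge_term R setT (fun k => Q i k * submx_pow Q setT 0 k j)%E j _ I.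
rewrite /= eqxx mule1; apply => k _.
by rewrite mule_ge0// lee_fin.
Qed.

Lemma leads_to0 j : leads_to Q 0 j -> j = 0%N.
Proof.
move=> [n _]; apply: (@submx_pow_closed _ _ _ [set 0%N]) => // i k ->.
by rewrite Q0row lte_fin; case: eqP => //; rewrite ltxx.
Qed.

Lemma step_low i j : (i <= m)%N -> (0 < Q i j)%E -> j = 0%N.
Proof.
case: i => [|i] im; first by rewrite Q0row lte_fin; case: eqP => //; rewrite ltxx.
by case: j => // j; rewrite Qlow ?ltxx.
Qed.

Lemma step_mid i j : (i <= N)%N -> (0 < Q i j)%E -> (j <= m)%N.
Proof.
case: i => [|i] iN.
  by rewrite Q0row lte_fin; case: eqP => [->//|]; rewrite ltxx.
by rewrite leqNgt; apply: contraTN => mj; rewrite Qmid ?ltxx.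
Qed.

Lemma leads_to_mid i j : (i <= N)%N -> leads_to Q i j -> (j <= N)%N.
Proof.
move=> iN [n _].
apply: (@submx_pow_closed _ _ _ [set k | (k <= N)%N]) => // k l /= kN.
by move=> /(step_mid _ _ kN) lm; exact: leq_trans mN.
Qed.

(** From a state 0 < i <= N, two steps lead to 0, which is absorbing. *)
Lemma recurrent_high i : i != 0%N -> leads_to Q i i -> (N < i)%N.
Proof.
move=> i0 [[//|n] _ h]; rewrite ltnNge; apply/negP => iN.
have [k Qik {}h] := submx_powS_gt0 _ _ _ _ _ _ Q0 h.
have km := step_mid _ _ iN Qik.
move/eqP: i0; apply; case: n h => [|n] h.
  have ki : k = i by move: h; rewrite /= lte_fin; case: eqP => //; rewrite ltxx.
  by rewrite ki in km Qik; exact: step_low km Qik.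
have [l Qkl {}h] := submx_powS_gt0 _ _ _ _ _ _ Q0 h.
rewrite (step_low _ _ km Qkl) in h.
case: n h => [|n] h; last by apply: leads_to0; exists n.+1.
by move: h; rewrite /= lte_fin; case: eqP => //; rewrite ltxx.
Qed.

Lemma class_high i : (N < i)%N -> [set j | communicates Q i j] = [set j | (N < j)%N].
Proof.
move=> Ni; apply/seteqP; split => j /=.
- move=> [_ ji]; rewrite ltnNge; apply/negP => jN.
  by have := leads_to_mid _ _ jN ji; rewrite leqNgt Ni.
- by move=> Nj; split; exact: leads_to_high.
Qed.

Lemma irreducible_class_high : irreducible_class Q [set j | (N < j)%N].
Proof.
exists N.+1; first by split; exact: leads_to_high.
by rewrite class_high.
Qed.

Lemma irreducible_class_unique S : irreducible_class Q S -> S <> [set 0%N] ->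
  S = [set j | (N < j)%N].
Proof.
move=> [i [ii _] ->] S0.
have [i0|i0] := eqVneq i 0%N; last by rewrite class_high//; exact: recurrent_high.
case: S0; rewrite i0 in ii *; apply/seteqP; split => j /=.
  by move=> [/leads_to0].
by move=> ->.
Qed.

End classes.

(** * A rational generating series *)

(** Coefficients of the power series A / (1 - al - be Y). *)
Fixpoint tail_column {R : fieldType} (A : nat -> R) (al be : R) (j : nat) : R :=
  (A j + be * (if j is j'.+1 then tail_column A al be j' else 0)) / (1 - al).

Lemma tail_columnE (R : fieldType) (A : nat -> R) (al be : R) j : 1 - al != 0 ->
  (1 - al) * tail_column A al be j =
  A j + be * (if j is j'.+1 then tail_column A al be j' else 0).
Proof. by move=> al1; case: j => [|j] /=; rewrite mulrC divfK. Qed.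

(** With t = be / (1 - al), the coefficient of Y^j in A / (1 - t Y) is
    sum_(l <= j) A_l t^(j - l), which is t^j A(1 / t) once j reaches the degree
    of A. *)
Lemma tail_column_horner (R : fieldType) (A : {poly R}) (al be : R) (j : nat) :
  1 - al != 0 -> be != 0 -> (size A <= j.+1)%N ->
  (1 - al) * tail_column (fun l => A`_l) al be j =
  (be / (1 - al)) ^+ j * A.[(be / (1 - al))^-1].
Proof.
move=> al1 be0 sA; set t := be / (1 - al).
have t0 : t != 0 by rewrite mulf_neq0 ?invr_eq0.
rewrite (horner_coef_wide _ sA) => {sA}; elim: j => [|j IH].
  by rewrite tail_columnE// mulr0 addr0 big_ord1 !expr0 mulr1 mul1r.
rewrite tail_columnE// big_ord_recr/= mulrDr exprVn addrC.
rewrite mulrCA mulfV ?expf_neq0// mulr1.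
by rewrite exprS -mulrA -IH mulrA /t divfK.
Qed.

(** * Null cookies *)

Definition zeros {R : realType} (c : nat -> R) (n : nat) : nat :=
  (\sum_(l < n) (c l == 0%R))%N.

Section zeros.
Variables (R : realType) (c : nat -> R) (b M : nat) (q : R).

Lemma zerosS n : zeros c n.+1 = (zeros c n + (c n == 0%R))%N.
Proof. by rewrite /zeros big_ord_recr. Qed.

Lemma zeros_ge m n : (forall l, (l < m)%N -> c l = 0) -> (minn n m <= zeros c n)%N.
Proof.
move=> cm; elim: n => [|n IH]; first by rewrite min0n.
rewrite zerosS; have [nm|mn] := ltnP n m; first by rewrite cm// eqxx; lia.
by lia.
Qed.

Lemma count_prob_lt_zeros n f o : (f < zeros c n)%N -> count_prob c b n f o = 0.
Proof.
elim: n f o => [|n IH] f o; first by rewrite /zeros big_ord0.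
rewrite zerosS /=; case: eqP => [->|_]; last first.
  rewrite addn0 => fz; rewrite (IH f o)// mulr0 addr0.
  rewrite (_ : (if f is _.+1 then _ else _) = 0); last first.
    by case: f fz => // f fz; apply: IH; lia.
  rewrite (_ : (if o is _.+1 then _ else _) = 0) ?mulr0 ?addr0//.
  by case: o => // o; exact: IH.
rewrite addn1 ltnS !mul0r !addr0 => fz.
by case: f fz => [|f] fz; rewrite ?mulr0// IH ?mulr0//.
Qed.

Hypothesis c01 : forall n, 0 <= c n < 1.
Hypothesis b2 : (1 < b)%N.
Hypothesis q0 : 0 < q.
Hypothesis cM : forall n, (M <= n)%N -> c n = q.

Lemma zeros_after n : (M <= n)%N -> zeros c n = zeros c M.
Proof.
elim: n => [|n IH]; first by rewrite leqn0 => /eqP ->.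
rewrite leq_eqVlt => /predU1P[->//|Mn].
by rewrite zerosS cM// gt_eqF// addn0 IH.
Qed.

(** When b > 1 a trial whose cookie is not null may yield neither a failure nor
    a one, so it is possible that nothing occurs beyond the failures forced by
    the null cookies. *)
Lemma count_prob_zeros_gt0 n : 0 < count_prob c b n (zeros c n) 0.
Proof.
have b0 : 0 < b%:R :> R by rewrite ltr0n ltnW.
have b10 : 0 < b%:R - 1 :> R by rewrite subr_gt0 ltr1n.
elim: n => [|n IH]; first by rewrite /zeros big_ord0 /= ltr01.
rewrite zerosS /= mulr0 addr0.
have /andP[cn0 cn1] := c01 n.
have [cz|cz] := eqVneq (c n) 0.
  by rewrite cz addn1 !mul0r addr0 subr0 mul1r.
have cp : 0 < c n by rewrite lt_def cz.
rewrite addn0 ltr_wpDl ?mulr_gt0 ?invr_gt0//.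
rewrite mulr_ge0 ?subr_ge0 ?(ltW cn1)//.
by case: (zeros c n) => // f; apply: count_prob_ge0 => //; exact: ltnW.
Qed.

Lemma count_prob_after_gt0 k j :
  0 < count_prob c b (M + (k + j)) (zeros c M + k) j.
Proof.
have b0 : 0 < b%:R :> R by rewrite ltr0n ltnW.
have b10 : 0 < b%:R - 1 :> R by rewrite subr_gt0 ltr1n.
have nn n f o : 0 <= count_prob c b n f o.
  by apply: count_prob_ge0 => //; exact: ltnW.
have q1 : 0 < 1 - q by have /andP[_] := c01 M; rewrite cM// subr_gt0.
elim: j => [|j IH].
  rewrite addn0; elim: k => [|k IH].
    by rewrite !addn0; exact: count_prob_zeros_gt0.
  rewrite !addnS /= cM ?leq_addr// mulr0 addr0.
  by rewrite ltr_pwDl ?mulr_gt0// !mulr_ge0 ?invr_ge0 ?(ltW q0) ?(ltW b10) ?(ltW b0).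
rewrite !addnS /= cM ?leq_addr//.
rewrite -addrA ltr_wpDl//.
  by rewrite mulr_ge0 ?(ltW q1)//; case: (zeros c M + k)%N.
by rewrite ltr_pwDl ?mulr_gt0 ?invr_gt0// !mulr_ge0 ?invr_ge0 ?(ltW q0) ?(ltW b10)
  ?(ltW b0).
Qed.

End zeros.

(** * The spectral radius of the cookie matrix *)

Lemma exprn_small (R : realType) (x e : R) : 0 <= x < 1 -> 0 < e ->
  exists N, forall n, (N <= n)%N -> x ^+ n <= e.
Proof.
move=> /andP[x0 x1] e0.
have : x ^+ n @[n --> \oo] --> (0 : R) by apply: cvg_expr; rewrite ger0_norm.
move=> /cvgrPdist_le /(_ e e0) [N _ hN]; exists N => n Nn.
by have := hN n Nn; rewrite /= sub0r normrN ger0_norm// exprn_ge0.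
Qed.

Section cookie_spectral_radius.
Variables (R : realType) (c : nat -> R) (b M m : nat) (q : R).
Variable (Q : nat -> nat -> \bar R).
Hypothesis c01 : forall n, 0 <= c n < 1.
Hypothesis b2 : (1 < b)%N.
Hypothesis M0 : (0 < M)%N.
Hypothesis q01 : 0 < q < 1.
Hypothesis cM : forall n, (M <= n)%N -> c n = q.
Hypothesis cm : forall l, (l < m)%N -> c l = 0.
Hypothesis mM : (M <= m + m.+1)%N.
Hypothesis mleM : (m <= M)%N.
Hypothesis qb : q < b%:R / (b%:R + 1).
Hypothesis Q0row : forall j, Q 0%N j = ((j == 0%N)%:R)%:E.
Hypothesis QS : forall i j, Q i.+1 j =
  (\sum_(n <oo) (count_prob c b n i j * (1 - c n))%:E)%E.

Let N := zeros c M.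
Let S : set nat := [set j | (N < j)%N].
Let r := q / (b%:R * (1 - q)).

Local Lemma q0 : 0 < q. Proof. by case/andP: q01. Qed.
Local Lemma q1 : 0 < 1 - q. Proof. by case/andP: q01; rewrite subr_gt0. Qed.
Local Lemma b0 : 0 < b%:R :> R. Proof. by rewrite ltr0n ltnW. Qed.
Local Lemma b10 : (0 < b)%N. Proof. exact: ltnW. Qed.

Local Lemma count_nn n i j : (0 <= (count_prob c b n i j * (1 - c n))%:E)%E.
Proof.
rewrite lee_fin mulr_ge0 ?(@count_prob_ge0 _ _ _ c01 b10)//.
by have /andP[_ /ltW] := c01 n; rewrite subr_ge0.
Qed.

Lemma cookie_entry_ge0 i j : (0 <= Q i j)%E.
Proof.
case: i => [|i]; first by rewrite Q0row lee_fin.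
by rewrite QS; apply: nneseries_ge0 => n _ _; exact: count_nn.
Qed.

Lemma null_cookies_ge : (m <= N)%N.
Proof. by have := zeros_ge _ c m M cm; rewrite /N; lia. Qed.

Lemma cookie_row_gt0 i j : (N < i)%N -> (0 < Q i j)%E.
Proof.
case: i => // i; rewrite ltnS => Ni; rewrite QS.
rewrite (@nneseriesD1 _ _ (M + (i - N + j))%N)//; last first.
  by move=> n _; exact: count_nn.
apply: (@lt_le_trans _ _ (count_prob c b (M + (i - N + j)) i j *
    (1 - c (M + (i - N + j))%N))%:E).
  rewrite lte_fin cM ?leq_addr// mulr_gt0 ?q1//.
  have := count_prob_after_gt0 _ c b M q c01 b2 q0 cM (i - N) j.
  by rewrite -/N subnKC.
by rewrite leeDl// nneseries_ge0// => n _ _; exact: count_nn.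
Qed.

(** If the failure number i <= N takes place at a trial n < M, then at least
    min(n, m) of the n earlier trials failed, which leaves room for at most
    M - 1 - m <= m ones. It cannot take place later, because N failures have
    occurred by then. *)
Lemma cookie_mid_eq0 i j : (0 < i <= N)%N -> (m < j)%N -> Q i j = 0%E.
Proof.
case: i => // i /= iN mj; rewrite QS eseries0// => n _ _.
suff -> : count_prob c b n i j = 0 by rewrite mul0r.
have [Mn|nM] := leqP M n.
  by apply: count_prob_lt_zeros; rewrite (zeros_after _ c M q q0 cM).
have [iz|zi] := ltnP i (zeros c n); first exact: count_prob_lt_zeros.
apply: count_prob_eq0; have := zeros_ge _ c m n cm; lia.
Qed.

Lemma cookie_low_eq0 i j : (0 < i <= m)%N -> (0 < j)%N -> Q i j = 0%E.
Proof.
case: i => // i /= im j0; rewrite QS eseries0// => n _ _.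
suff -> : count_prob c b n i j = 0 by rewrite mul0r.
have [iz|zi] := ltnP i (zeros c n); first exact: count_prob_lt_zeros.
apply: count_prob_eq0; have := zeros_ge _ c m n cm; lia.
Qed.

Let al s := (1 - q) * s + (b%:R - 1) * q / b%:R.
Let be := q / b%:R.
Let x s := tail_column (fun l => (count_poly c b s M)`_l) (al s) be.

Lemma one_sub_al s : 1 - al s = (1 - q) * (1 - s) + be.
Proof. by rewrite /al /be; field; rewrite gt_eqF ?b0. Qed.

Lemma one_sub_al_gt0 s : s < 1 -> 0 < 1 - al s.
Proof.
move=> s1; rewrite one_sub_al addr_gt0//; first by rewrite mulr_gt0 ?q1 ?subr_gt0.
by rewrite divr_gt0 ?q0 ?b0.
Qed.

(** The rows 0 < i <= N vanish at the column k, so the sum over the class is the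
    sum over all positive i. *)
Lemma column_sum (s : R) k : 0 <= s < 1 -> S k ->
  (\esum_(i in S) ((s ^+ i)%:E * Q i k) = (s * (1 - q) * x s k)%:E)%E.
Proof.
move=> s01 Sk; have /andP[s0 s1] := s01.
have mk : (m < k)%N by exact: leq_ltn_trans null_cookies_ge Sk.
have nn i : (0 <= (s ^+ i)%:E * Q i k)%E.
  by rewrite mule_ge0 ?cookie_entry_ge0// lee_fin exprn_ge0.
rewrite esum_nneseries// eseries_mkcond nneseries_recl//; last first.
  by move=> i _; case: ifP.
rewrite ifF; last by apply/negbTE; rewrite notin_setE.
rewrite add0e -nneseries_addn; last by move=> i; case: ifP.
transitivity (\sum_(i <oo) ((s ^+ i.+1)%:E *
    \sum_(n <oo) (count_prob c b n i k * (1 - c n))%:E))%E.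
  apply: eq_eseriesr => i _; rewrite addn1 -QS; case: ifPn => //.
  rewrite notin_setE /S /= => /negP; rewrite -leqNgt => iN.
  by rewrite cookie_mid_eq0 ?mule0.
rewrite (weighted_column _ _ _ c01 b10 _ _ cM _ m)//; last by lia.
rewrite (count_poly_series _ _ _ c01 b10 _ _ cM _ (x s))//.
- have h := one_sub_al_gt0 _ s1.
  by rewrite /x tail_columnE ?gt_eqF// mulr0 addr0.
- by move=> j; have h := one_sub_al_gt0 _ s1; rewrite /x tail_columnE ?gt_eqF.
Qed.

Lemma r_gt0 : 0 < r. Proof. by rewrite divr_gt0 ?mulr_gt0 ?q0 ?q1 ?b0. Qed.

Lemma r_lt1 : r < 1.
Proof.
rewrite ltr_pdivrMr ?mulr_gt0 ?q1 ?b0// mul1r.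
move: qb; rewrite ltr_pdivlMr; last by rewrite addr_gt0 ?b0.
by move=> h; nra.
Qed.

Lemma be_r : be = r * (1 - q).
Proof. by rewrite /be /r; field; rewrite ?gt_eqF ?b0 ?q1. Qed.

Definition cookie_eigenvalue := r * (count_poly c b r M).[r^-1].

(** At s = r one has 1 - al = 1 - q and be / (1 - al) = r: the fixed point of
    s |-> be / (1 - al s) other than 1. *)
Lemma left_eigenvector_cookie k : S k ->
  (\esum_(i in S) ((r ^+ i)%:E * Q i k) = (cookie_eigenvalue * r ^+ k)%:E)%E.
Proof.
move=> Sk; rewrite column_sum ?r_lt1 ?(ltW r_gt0)//.
have mk : (m < k)%N by exact: leq_ltn_trans null_cookies_ge Sk.
have a1 : 1 - al r = 1 - q by rewrite one_sub_al be_r; ring.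
have t : be / (1 - al r) = r by rewrite a1 be_r mulfK// gt_eqF ?q1.
have := @tail_column_horner _ (count_poly c b r M) (al r) be k.
rewrite t a1 => H; rewrite -mulrA /x H.
- by rewrite /cookie_eigenvalue; congr (_%:E); ring.
- by rewrite gt_eqF ?q1.
- by rewrite be_r; apply: lt0r_neq0; exact: mulr_gt0 r_gt0 q1.
- by apply/leq_sizeP => j kj; apply: (@count_poly_coef_eq0 _ c b r m) => //; lia.
Qed.

Lemma cookie_eigenvalue_gt0 : 0 < cookie_eigenvalue.
Proof.
rewrite mulr_gt0 ?r_gt0// /count_poly horner_prod prodr_gt0// => l _.
rewrite hornerD hornerC hornerZ hornerX; have /andP[cl0 cl1] := c01 l.
have bn := ltW b0.
apply: ltr_wpDr; first exact: divr_ge0 (divr_ge0 cl0 bn) (ltW r_gt0).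
apply: ltr_wpDr; last by apply: mulr_gt0; [rewrite subr_gt0|exact: r_gt0].
by rewrite !mulr_ge0 ?invr_ge0// subr_ge0 ler1n b10.
Qed.

(** Beyond M the column sums y_k are geometric of ratio t = be / (1 - al), and
    s (1 - al) - be = (1 - q) (1 - s) (s - r) shows that t < s. So eps s^k
    dominates all columns but finitely many, and K r^k takes care of the rest. *)
Lemma lyapunov_cookie (s : R) : r < s -> s < 1 -> forall eps, 0 < eps ->
  exists2 K, 0 <= K & forall k, S k ->
  (\esum_(i in S) ((s ^+ i)%:E * Q i k) <= (eps * s ^+ k + K * r ^+ k)%:E)%E.
Proof.
move=> rs s1 eps eps0.
have s0 : 0 < s by exact: lt_trans r_gt0 rs.
have d0 := one_sub_al_gt0 _ s1.
pose y j := s * (1 - q) * x s j.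
pose t := be / (1 - al s).
have be0 : 0 < be by rewrite divr_gt0 ?q0 ?b0.
have t0 : 0 < t by rewrite divr_gt0.
have ts : t < s.
  rewrite /t ltr_pdivrMr// one_sub_al be_r -subr_gt0.
  have -> : s * ((1 - q) * (1 - s) + r * (1 - q)) - r * (1 - q) =
    (1 - q) * (1 - s) * (s - r) by ring.
  by rewrite !mulr_gt0 ?q1// subr_gt0.
have yS j : (M <= j)%N -> y j.+1 = t * y j.
  move=> Mj; rewrite /y /t /x /= (@count_poly_coef_eq0 _ c b s 0 M j.+1)//; last by lia.
  by rewrite add0r; ring.
have yE k : y (M + k)%N = t ^+ k * y M.
  elim: k => [|k IH]; first by rewrite addn0 expr0 mul1r.
  by rewrite addnS yS ?leq_addr// IH exprS mulrA.
have x0 j : 0 <= x s j.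
  elim: j => [|j IH]; rewrite /x /= divr_ge0 ?(ltW d0)// addr_ge0 ?mulr0
    ?count_poly_ge0 ?b10 ?(ltW s0)//.
  by rewrite mulr_ge0 ?(ltW be0).
have y0 j : 0 <= y j by rewrite !mulr_ge0 ?(ltW s0) ?(ltW q1).
have [J hJ] : exists J, forall n, (J <= n)%N ->
    (t / s) ^+ n <= eps * s ^+ M / (y M + 1).
  apply: exprn_small.
    by rewrite divr_ge0 ?(ltW t0) ?(ltW s0)//= ltr_pdivrMr// mul1r.
  by rewrite divr_gt0 ?mulr_gt0 ?exprn_gt0// ltr_wpDl.
exists (\sum_(j < M + J) y j / r ^+ j).
  by rewrite sumr_ge0// => j _; rewrite divr_ge0// exprn_ge0// ltW ?r_gt0.
move=> k Sk; rewrite column_sum ?(ltW s0)// lee_fin -/(y k).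
have [kJ|Jk] := ltnP k (M + J).
  apply: (@le_trans _ _ ((y k / r ^+ k) * r ^+ k)).
    by rewrite divfK// expf_neq0// gt_eqF ?r_gt0.
  apply: ler_wpDl; first by rewrite mulr_ge0 ?exprn_ge0 ?(ltW s0) ?(ltW eps0).
  rewrite ler_wpM2r ?exprn_ge0 ?(ltW r_gt0)//.
  rewrite (bigD1 (Ordinal kJ))//= lerDl sumr_ge0// => j _.
  by rewrite divr_ge0// exprn_ge0// ltW ?r_gt0.
apply: ler_wpDr.
  rewrite mulr_ge0 ?exprn_ge0 ?(ltW r_gt0)// sumr_ge0// => j _.
  by rewrite divr_ge0// exprn_ge0// ltW ?r_gt0.
have -> : k = (M + (k - M))%N by rewrite subnKC//; lia.
have {}Jk : (J <= k - M)%N by lia.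
move: (k - M)%N Jk => n Jn; rewrite yE exprD (mulrA eps).
have := hJ n Jn; rewrite expr_div_n ler_pdivrMr ?exprn_gt0// => tn.
apply: (@le_trans _ _ (eps * s ^+ M / (y M + 1) * s ^+ n * y M)).
  by rewrite ler_wpM2r.
rewrite (mulrAC _ _ (y M)) ler_wpM2r ?exprn_ge0 ?(ltW s0)//.
rewrite mulrAC ler_pdivrMr; last by rewrite ltr_wpDl.
apply: ler_wpM2l; last by rewrite lerDl.
by apply: mulr_ge0; [exact: ltW|rewrite exprn_ge0// ltW].
Qed.

Lemma cookie_spectral_radius : is_spectral_radius Q S cookie_eigenvalue%:E.
Proof.
have rl : r < 1 := r_lt1.
have r0 := r_gt0.
pose s := (1 + r) / 2.
have rs : r < s by rewrite /s; lra.
have s1 : s < 1 by rewrite /s; lra.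
have s0 : 0 < s by exact: lt_trans r0 rs.
have l0 := cookie_eigenvalue_gt0.
have e0 : 0 < cookie_eigenvalue / 2 by rewrite divr_gt0.
have [K K0 hK] := lyapunov_cookie s rs s1 _ e0.
apply: (spectral_radius_left_eigenvector _ Q S cookie_entry_ge0 cookie_eigenvalue
  (fun i => r ^+ i) l0 _ _ (fun i => s ^+ i) (cookie_eigenvalue / 2) K).
- by move=> i; rewrite exprn_gt0.
- exact: left_eigenvector_cookie.
- by move=> i; rewrite exprn_gt0.
- exact: ltW.
- by lra.
- exact: K0.
- exact: hK.
- move=> eta eta0; have [|J hJ] := exprn_small _ (r / s) eta _ eta0.
    by rewrite divr_ge0 ?(ltW r0) ?(ltW s0)//= ltr_pdivrMr// mul1r.
  exists J => i /hJ; rewrite expr_div_n ler_pdivrMr// exprn_gt0//.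
- by move=> i j Si _; exact: cookie_row_gt0.
Qed.

Lemma cookie_largest_spectral_radius :
  is_largest_spectral_radius Q cookie_eigenvalue%:E.
Proof.
have S0 : S <> [set 0%N] by move=> /seteqP[_ /(_ 0%N erefl)].
split=> [|S' S'_class S'0].
  exists S; split => //; last exact: cookie_spectral_radius.
  exact: (irreducible_class_high _ Q m N cookie_entry_ge0 Q0row null_cookies_ge
    cookie_row_gt0 cookie_mid_eq0).
exists cookie_eigenvalue%:E => //.
rewrite (irreducible_class_unique _ Q m N cookie_entry_ge0 Q0row null_cookies_ge
  cookie_row_gt0 cookie_mid_eq0 cookie_low_eq0 S')//.
exact: cookie_spectral_radius.
Qed.

End cookie_spectral_radius.

Theorem theorem1p4 (R : realType) (b M : nat) (p : 'I_M -> R) (q : R)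
    (d : measure_display) (T : measurableType d) (Pr : probability T R)
    (xi : nat -> {RV Pr >-> nat}) :
  (2 <= b)%N ->
  is_cookie_env p q ->
  is_cookie_sequence b p q xi ->
  (forall i : 'I_M, (i < M./2)%N -> p i = 0) ->
  q < b%:R / (b%:R + 1) ->
  is_largest_spectral_radius (cookie_matrix xi) (lambda_sym b p q)%:E.
Proof.
move=> b2 [M0 p01 q01] [xi_indep _ xi0 xi1] pm qb.
pose c := cookie_strength p q.
have b1 : (0 < b)%N by exact: ltnW.
have c01 n : 0 <= c n < 1.
  rewrite /c /cookie_strength; case: insubP => [i _ _|_]; first exact: p01.
  by case/andP: q01 => /ltW -> ->.
have cM n : (M <= n)%N -> c n = q.
  by rewrite /c /cookie_strength => Mn; rewrite insubF// ltnNge Mn.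
have cp (i : 'I_M) : c i = p i by rewrite /c /cookie_strength valK.
have mM : (M <= M./2 + M./2.+1)%N by lia.
have mleM : (M./2 <= M)%N by lia.
have cm l : (l < M./2)%N -> c l = 0.
  by move=> lm; rewrite (cp (Ordinal (leq_trans lm mleM))) pm.
have Q0row j : cookie_matrix xi 0 j = ((j == 0%N)%:R)%:E by [].
have QS := cookie_matrixS _ _ _ _ xi c b b1 xi_indep xi0 (fun n => xi1 n 1%N b1).
have -> : lambda_sym b p q = cookie_eigenvalue _ c b M q.
  rewrite /lambda_sym /cookie_eigenvalue /count_poly horner_prod; congr (_ * _).
  by apply: eq_bigr => i _; rewrite hornerD hornerC hornerZ hornerX cp.
exact: (cookie_largest_spectral_radius _ c b M M./2).
Qed.
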